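(* Let $G$ be a group, $R$ a commutative $G$-graded ring with nonzero unity, $M$ a nonzero $G$-graded $R$-module, and $K$ a proper graded $R$-submodule of $M$. Then $K$ is a graded special $r$-submodule of $M$ if and only if for every graded $R$-submodule $N$ of $M$ with $N\cap(h(M)-T(M))\neq\emptyset$ and every graded ideal $I$ of $R$ with $IN\subseteq K$, one has $I\subseteq (K:_R M)$.
   Context: A commutative ring $R$ is $G$-graded if $R=\bigoplus_{g\in G}R_g$ with additive subgroups $R_g$ satisfying $R_gR_h\subseteq R_{gh}$; an $R$-module $M$ is $G$-graded if $M=\bigoplus_{g\in G}M_g$ with additive subgroups $M_g$ satisfying $R_gM_h\subseteq M_{gh}$. Put $h(R)=\bigcup_{g\in G}R_g$ and $h(M)=\bigcup_{g\in G}M_g$. An ideal $I$ of $R$ is graded if $I=\bigoplus_{g\in G}(I\cap R_g)$; an $R$-submodule $K$ of $M$ is graded if $K=\bigoplus_{g\in G}(K\cap M_g)$. Notation: $(K:_R M)=\{r\in R: rM\subseteq K\}$; $Ann_R(x)=\{r\in R: rx=0\}$ for $x\in M$; $T(M)=\{x\in M: Ann_R(x)\neq\{0\}\}$; $h(M)-T(M)$ is the set difference; $IN$ is the $R$-submodule generated by all products $rn$ with $r\in I$, $n\in N$. A proper graded $R$-submodule $K$ of $M$ is a graded special $r$-submodule if whenever $a\in h(R)$ and $x\in h(M)$ satisfy $ax\in K$ and $Ann_R(x)=\{0\}$, then $a\in(K:_R M)$. *)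

(* Defs.v *)
From mathcomp Require Import all_boot all_algebra.
From mathcomp Require Import all_classical.

Set Implicit Arguments.
Unset Strict Implicit.
Unset Printing Implicit Defensive.

Import GRing.Theory.
Local Open Scope classical_set_scope.
Local Open Scope ring_scope.

Section DirectSum.
Variables (I : choiceType) (V : zmodType).

Definition finsupp_families (A : I -> set V) : set (I -> V) :=
  [set f | finite_set (f @^-1` [set~ 0]) /\ forall i, A i (f i)].

(* The internal direct sum S = (+)_i A_i of additive subgroups A_i of V: every
   element of S is the sum of exactly one finitely supported family of
   elements of the A_i, and all such sums lie in S. *)
Definition is_direct_sum (A : I -> set V) (S : set V) : Prop :=
  set_bij (finsupp_families A) S (fun f => \sum_(i \in [set: I]) f i).

End DirectSum.

Section Graded.
Variable G : groupType.

Definition graded_ring (R : comNzRingType) (Rg : G -> set R) : Prop :=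
  [/\ forall g, zmod_closed [in Rg g],
      is_direct_sum Rg [set: R] &
      forall g h a b, Rg g a -> Rg h b -> Rg (g * h)%g (a * b)].

Definition graded_module (R : comNzRingType) (Rg : G -> set R)
    (M : lmodType R) (Mg : G -> set M) : Prop :=
  [/\ forall g, zmod_closed [in Mg g],
      is_direct_sum Mg [set: M] &
      forall g h a x, Rg g a -> Mg h x -> Mg (g * h)%g (a *: x)].

Definition homogeneous (V : zmodType) (Vg : G -> set V) : set V :=
  \bigcup_g Vg g.

Definition submodule (R : comNzRingType) (M : lmodType R) (K : set M) : Prop :=
  submod_closed [in K].

Definition graded_submodule (R : comNzRingType) (M : lmodType R)
    (Mg : G -> set M) (K : set M) : Prop :=
  submodule K /\ is_direct_sum (fun g => K `&` Mg g) K.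

(* Ideals of R are the submodules of the regular module R^o. *)
Definition ideal (R : comNzRingType) (J : set R) : Prop :=
  submodule (J : set R^o).

Definition graded_ideal (R : comNzRingType) (Rg : G -> set R) (J : set R) :
    Prop :=
  ideal J /\ is_direct_sum (fun g => J `&` Rg g) J.

Section Module.
Variables (R : comNzRingType) (M : lmodType R).

(* (K :_R M) *)
Definition colon (K : set M) : set R := [set r | forall x, K (r *: x)].

Definition Ann (x : M) : set R := [set r | r *: x = 0].

(* T(M) *)
Definition torsion : set M := [set x | Ann x <> [set 0]].

Definition ideal_mul (J : set R) (N : set M) : set M :=
  smallest (@submodule R M) [set r *: n | r in J & n in N].

Definition graded_special_r_submodule (Rg : G -> set R) (Mg : G -> set M)
    (K : set M) : Prop :=
  [/\ graded_submodule Mg K,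
      K <> [set: M] &
      forall a x, homogeneous Rg a -> homogeneous Mg x ->
        K (a *: x) -> Ann x = [set 0] -> colon K a].

End Module.
End Graded.

Arguments torsion {R} M.

(* Main.v *)
Require Import Defs.
From mathcomp Require Import all_boot all_algebra.
From mathcomp Require Import all_classical.

(** Both conditions speak of the same products: an element [a] of the ring and
    an element [x] with zero annihilator such that [a *: x] lies in [K].

    The submodule condition gives the elementwise one by taking principal
    submodules.  If [a] and [x] are homogeneous with [a *: x] in [K], then
    [I := R a] and [N := R x] are graded ([graded_submodule_cyclic]): scaling
    [x], of degree [h], by the homogeneous components of [r] produces those of
    [r *: x], with all degrees translated by [h].  Every [(s * a) *: (t *: x)]
    is a multiple of [a *: x], so [I N] lies in [K].

    Conversely, let [x] be a homogeneous nontorsion element of [N].  An element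
    [r] of [I] need not be homogeneous, but as [I] is graded its homogeneous
    components [r_g] lie in [I] too, so [r_g *: x] lies in [I N], hence in [K].
    The elementwise condition puts each [r_g] in [colon K], and therefore also
    their sum [r]. *)

Set Implicit Arguments.
Unset Strict Implicit.
Unset Printing Implicit Defensive.

Import GRing.Theory.
Local Open Scope classical_set_scope.
Local Open Scope ring_scope.

Lemma submoduleP (R : comNzRingType) (M : lmodType R) (K : set M) :
  submodule K <-> K 0 /\ forall a u v, K u -> K v -> K (a *: u + v).
Proof.
split=> [[K0 KD]|[K0 KD]].
  split=> [|a u v Ku Kv]; first by rewrite inE in K0.
  by apply/set_mem/KD; apply/mem_set.
split=> [|a u v /set_mem Ku /set_mem Kv]; first exact/mem_set.
exact/mem_set/KD.
Qed.

Lemma submoduleZ (R : comNzRingType) (M : lmodType R) (K : set M) a u :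
  submodule K -> K u -> K (a *: u).
Proof. by move=> /submoduleP[K0 KD] Ku; rewrite -[_ *: _]addr0; apply: KD. Qed.

Lemma submodule_fsum (R : comNzRingType) (M : lmodType R) (K : set M)
    (I : choiceType) (f : I -> M) :
  submodule K -> (forall i, K (f i)) -> K (\sum_(i \in [set: I]) f i).
Proof.
move=> /submoduleP[K0 KD] Kf; apply: big_ind => // u v Ku Kv.
by rewrite -[u]scale1r; apply: KD.
Qed.

(** Finiteness of the support matters: a sum over an infinite support is [0] by
    convention, whereas multiplication by [x] may make the support finite. *)
Lemma scaler_fsuml (R : comNzRingType) (M : lmodType R) (I : choiceType)
    (r : I -> R) (x : M) :
  finite_set (r @^-1` [set~ 0]) ->
  (\sum_(i \in [set: I]) r i) *: x = \sum_(i \in [set: I]) r i *: x.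
Proof.
move=> finr.
pose A := fset_set (r @^-1` [set~ 0]).
rewrite (fsbigTE A r) => [|i]; last first.
  by rewrite in_fset_set// notin_setE /= => /contrapT.
rewrite (fsbigTE A (fun i => r i *: x)) ?scaler_suml// => i.
by rewrite in_fset_set// notin_setE /= => /contrapT ->; rewrite scale0r.
Qed.

Section Cyclic.
Variables (G : groupType) (R : comNzRingType) (Rg : G -> set R).
Variables (M : lmodType R) (Mg : G -> set M).

Lemma submodule_cyclic (x : M) : submodule (range (fun r : R => r *: x)).
Proof.
apply/submoduleP; split=> [|a _ _ [r _ <-] [s _ <-]].
  by exists 0; rewrite ?scale0r.
by exists (a * r + s); rewrite // scalerDl scalerA.
Qed.

(** Uniqueness of homogeneous decompositions is inherited from [M]; what needs
    an argument is that the components of [r *: x] are again multiples of [x],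
    which holds since the one of degree [g] is [r (g / h) *: x]. *)
Lemma graded_submodule_cyclic (h : G) (x : M) :
  is_direct_sum Rg [set: R] -> graded_module Rg Mg -> Mg h x ->
  graded_submodule Mg (range (fun r : R => r *: x)).
Proof.
move=> [_ _ sumR] [_ [_ injM _] MgZ] Mgx; split; first exact: submodule_cyclic.
split.
- move=> f [_ fP]; apply: submodule_fsum; first exact: submodule_cyclic.
  by move=> g; have [] := fP g.
- move=> f f' /set_mem[finf fP] /set_mem[finf' fP'].
  by apply: injM; apply/mem_set; split=> // g; [have [] := fP g|have [] := fP' g].
move=> _ [r _ <-]; have [c [finc cP] <-] := sumR r I.
exists (fun g => c (g / h)%g *: x); last first.
  rewrite scaler_fsuml//.
  rewrite (reindex_fsbigT (fun g => (g / h)%g) (fun g => c g *: x))//.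
  by exists (fun g => (g * h)%g) => g; [apply: mulgVK|apply: mulgK].
split=> [|g].
  apply: sub_finite_set (finite_image (fun g => (g * h)%g) finc) => g /= cg0.
  exists (g / h)%g; last exact: mulgVK.
  by move=> c0; apply: cg0; rewrite c0 scale0r.
split; first by exists (c (g / h)%g).
by rewrite -{1}[g](mulgVK h); apply: MgZ.
Qed.

End Cyclic.

Lemma graded_ring_regular (G : groupType) (R : comNzRingType)
    (Rg : G -> set R) :
  graded_ring Rg -> graded_module Rg (Rg : G -> set R^o).
Proof. by []. Qed.

Lemma nontorsionP (R : comNzRingType) (M : lmodType R) (x : M) :
  ~ torsion M x <-> Ann x = [set 0].
Proof. by split=> [/contrapT|Annx]. Qed.

Theorem theorem4p16 (G : groupType) (R : comNzRingType) (Rg : G -> set R)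
    (M : lmodType R) (Mg : G -> set M) (K : set M)
    (gradedR : graded_ring Rg) (gradedM : graded_module Rg Mg)
    (M_neq0 : exists x : M, x <> 0)
    (gradedK : graded_submodule Mg K) (properK : K <> [set: M]) :
  graded_special_r_submodule Rg Mg K <->
  (forall (N : set M) (I : set R),
     graded_submodule Mg N ->
     N `&` (homogeneous Mg `\` torsion M) !=set0 ->
     graded_ideal Rg I ->
     ideal_mul I N `<=` K ->
     I `<=` colon K).
Proof.
have [subK _] := gradedK; have [_ sumR _] := gradedR.
split=> [[_ _ specialK] N I _ [x [Nx [hx ntx]]]|idealK].
  have Annx := (nontorsionP x).1 ntx.
  move=> [_ [_ _ sumI]] INK r /sumI[c [finc cP] <-] y.
  rewrite scaler_fsuml//; apply: submodule_fsum => // g.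
  have [Icg Rcg] := cP g.
  apply: specialK hx _ Annx y; first by exists g.
  by apply: INK; apply: sub_gen_smallest; exists (c g) => //; exists x.
split=> // a x [g _ Rga] [h _ Mhx] Kax Annx.
apply: (idealK (range (fun r : R => r *: x))
               (range (fun r : R => r *: (a : R^o)))).
- exact: graded_submodule_cyclic sumR gradedM Mhx.
- exists x; split; first by exists 1; rewrite ?scale1r.
  by split; [exists h|apply/nontorsionP].
- exact: graded_submodule_cyclic sumR (graded_ring_regular gradedR) Rga.
- apply: smallest_sub => // _ [_ [s _ <-] [_ [t _ <-] <-]].
  have -> : (s *: (a : R^o)) *: (t *: x) = (s * t) *: (a *: x).
    by rewrite !scalerA mulrAC.
  exact: submoduleZ.
by exists 1; rewrite ?scale1r.
Qed.
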